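(* Let $q\in\mathbb{C}\setminus\{0,1\}$, let $X$ be a complex Banach space, and let $T,S\in\mathcal{B}(X)$ satisfy $TS=q^{-1}ST$. Then $$\sigma_x(T,S)=\sigma_l(T,S)\times\{0\}\quad\text{and}\quad \sigma_y(T,S)=\{0\}\times\sigma_r(T,S).$$ Thus $$\sigma(T,S)=\left(\sigma_l(T,S)\times\{0\}\right)\cup\left(\{0\}\times\sigma_r(T,S)\right)$$ is a union of compact subsets, and the following $q$-projection property holds: $$\sigma(T,S)\subseteq\left(\left(\sigma(T)\cup\sigma(q^{-1}T)\right)\times\{0\}\right)\cup\left(\{0\}\times\left(\sigma(S)\cup\sigma(qS)\right)\right).$$
   Context: $\mathcal{B}(X)$ is the algebra of bounded linear operators on $X$; for a single operator $A\in\mathcal{B}(X)$, $\sigma(A)$ is its usual spectrum. Put $\mathbb{C}_x=\mathbb{C}\times\{0\}\subseteq\mathbb{C}^2$, $\mathbb{C}_y=\{0\}\times\mathbb{C}\subseteq\mathbb{C}^2$ and $\mathbb{C}_{xy}=\mathbb{C}_x\cup\mathbb{C}_y$. For $\gamma=(\gamma(x),\gamma(y))\in\mathbb{C}_{xy}$ (so $\gamma(x)\gamma(y)=0$), let $\mathcal{K}((T,S),\gamma)$ be the Banach space complex $$0\to X\xrightarrow{d^0_\gamma}X\oplus X\xrightarrow{d^1_\gamma}X\to0,$$ $$d^0_\gamma(\theta)=\left((\gamma(y)-qS)\theta,\ (T-q\gamma(x))\theta\right),\qquad d^1_\gamma(\xi,\eta)=(T-\gamma(x))\xi+(S-\gamma(y))\eta.$$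 The joint (Taylor) spectrum is $\sigma(T,S)=\{\gamma\in\mathbb{C}_{xy}:\mathcal{K}((T,S),\gamma)\text{ is not exact}\}$, and $\sigma_x(T,S)=\sigma(T,S)\cap\mathbb{C}_x$, $\sigma_y(T,S)=\sigma(T,S)\cap\mathbb{C}_y$. For $\lambda\in\mathbb{C}$ let $\mathcal{L}_\lambda(T,S)$ be the complex $0\to X\xrightarrow{l^0_\lambda}X\oplus X\xrightarrow{l^1_\lambda}X\to0$ with $l^0_\lambda(\theta)=(S\theta,(\lambda-q^{-1}T)\theta)$ and $l^1_\lambda(\xi,\eta)=(\lambda-T)\xi-S\eta$. The left spectrum $\sigma_l(T,S)\subseteq\mathbb{C}$ is the set of all $\lambda\in\mathbb{C}$ for which $\mathcal{L}_\lambda(T,S)$ is not exact. For $\mu\in\mathbb{C}$ let $\mathcal{R}_\mu(T,S)$ be the complex $0\to X\xrightarrow{r^0_\mu}X\oplus X\xrightarrow{r^1_\mu}X\to0$ with $r^0_\mu(\theta)=(T\theta,(\mu-qS)\theta)$ and $r^1_\mu(\xi,\eta)=(\mu-S)\xi-T\eta$. The right spectrum $\sigma_r(T,S)\subseteq\mathbb{C}$ is the set of all $\mu\in\mathbb{C}$ for which $\mathcal{R}_\mu(T,S)$ is not exact. Compactness is with respect to the standard topology. *)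

(* Defs.v *)
From HB Require Import structures.
From mathcomp Require Import all_boot all_order all_algebra.
From mathcomp Require Import complex.
From mathcomp Require Import all_classical all_reals all_analysis.

Set Implicit Arguments.
Unset Strict Implicit.
Unset Printing Implicit Defensive.

Import Order.TTheory GRing.Theory Num.Theory.
Import numFieldNormedType.Exports.

Local Open Scope classical_set_scope.
Local Open Scope ring_scope.

(* R[i] behind a constant of type numClosedFieldType: MathComp-Analysis attaches
   its topology (here, the one of the complex modulus) to carriers of such
   structures, which the bare type R[i] does not syntactically exhibit. *)
Definition Cplx (R : realType) : numClosedFieldType := R[i].

Section BoundedOperators.
Context {R : realType} {X : completeNormedModType (Cplx R)}.
Local Notation C := (Cplx R).

Definition bounded_op (A : X -> X) : Prop :=
  exists M : C, forall x, `|A x| <= M * `|x|.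

Definition spectrum (A : X -> X) : set C :=
  [set lambda | ~ exists2 B : {linear X -> X}, bounded_op B &
      cancel (fun x => A x - lambda *: x) B /\
      cancel B (fun x => A x - lambda *: x)].

End BoundedOperators.

Section Spectra.
Context {R : realType} {X : completeNormedModType (Cplx R)}.
Local Notation C := (Cplx R).

(* Exactness of 0 -> X -> X (+) X -> X -> 0 at its three places. *)
Definition exact_complex (d0 : X -> X * X) (d1 : X * X -> X) : Prop :=
  [/\ d0 @^-1` [set 0] = [set 0],
      range d0 = d1 @^-1` [set 0] &
      range d1 = setT].

Definition C_x : set (C * C) := setT `*` [set 0].
Definition C_y : set (C * C) := [set 0] `*` setT.
Definition C_xy : set (C * C) := C_x `|` C_y.

Variables (q : C) (T S : X -> X).

Definition d0 (g : C * C) (theta : X) : X * X :=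
  (g.2 *: theta - q *: S theta, T theta - (q * g.1) *: theta).
Definition d1 (g : C * C) (u : X * X) : X :=
  (T u.1 - g.1 *: u.1) + (S u.2 - g.2 *: u.2).

Definition joint_spectrum : set (C * C) :=
  [set g | C_xy g /\ ~ exact_complex (d0 g) (d1 g)].
Definition sigma_x : set (C * C) := joint_spectrum `&` C_x.
Definition sigma_y : set (C * C) := joint_spectrum `&` C_y.

Definition l0 (lambda : C) (theta : X) : X * X :=
  (S theta, lambda *: theta - q^-1 *: T theta).
Definition l1 (lambda : C) (u : X * X) : X :=
  (lambda *: u.1 - T u.1) - S u.2.
Definition left_spectrum : set C :=
  [set lambda | ~ exact_complex (l0 lambda) (l1 lambda)].

Definition r0 (mu : C) (theta : X) : X * X :=
  (T theta, mu *: theta - q *: S theta).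
Definition r1 (mu : C) (u : X * X) : X :=
  (mu *: u.1 - S u.1) - T u.2.
Definition right_spectrum : set C :=
  [set mu | ~ exact_complex (r0 mu) (r1 mu)].

End Spectra.

(* Main.v *)
Require Import Defs.
From HB Require Import structures.
From mathcomp Require Import all_boot all_order all_algebra.
From mathcomp Require Import complex.
From mathcomp Require Import all_classical all_reals all_analysis.
From mathcomp Require Import ring lra.

Set Implicit Arguments.
Unset Strict Implicit.
Unset Printing Implicit Defensive.

Import Order.TTheory GRing.Theory Num.Theory.
Import numFieldNormedType.Exports.

Local Open Scope classical_set_scope.
Local Open Scope ring_scope.

(** The two identities of spectra are algebra: at (a, 0) the Koszul complex is
the complex L_a up to an automorphism of X (+) X and nonzero scalars, and at
(0, b) it is R_b up to exchanging the two summands. Moreover R_b for the triple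
(q, T, S) is L_b for (q^-1, S, T), so everything that remains has to be shown
for the left spectrum only.

If both lambda - T and lambda - q^-1 T are bijective, L_lambda is exact: a pair
(xi, eta) in the kernel of the second map is the image of
theta = (lambda - q^-1 T)^-1 eta, because (lambda - T) S theta = S eta =
(lambda - T) xi. This gives the projection property ([exact_of_regular]) and,
since both operators are bijective for large lambda, the boundedness of the
left spectrum.

The left spectrum is closed because exactness of a complex of Banach spaces
survives small perturbations ([exact_complex_stable]). Exactness and the open
mapping theorem give constants K0, K1 such that every cycle has a preimage
under d0, and every vector a preimage under d1, of norm controlled by K0 and
K1. For perturbed maps the same preimages are correct up to a fixed proportion
of the norm, and summing the successive corrections
([solve_by_approximation]) produces true preimages.

The open mapping theorem is needed for d0 as a map onto the kernel of d1, which
is a closed subset and not a Banach space given as a type. It is therefore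
proved ([open_mapping]) for a linear map whose range is complete as a subset,
by a gliding hump argument along a geometric series instead of Baire's theorem.
Completeness enters only through geometrically Cauchy sequences
([geom_complete]). All estimates use the norm as an element of R, where the
order is total. *)

(** * The real-valued norm *)

Section RealNorm.
Context {R : realType}.
Local Notation C := (Cplx R).
Implicit Types (V : normedZmodType C) (W : normedModType C).

(** The library norm takes its values in the scalar field, here in C, whose order
is partial. *)
Definition rnorm V (x : V) : R := complex.Re `|x|.

Lemma normrE V (x : V) : `|x| = (rnorm x)%:C%C :> R[i].
Proof. by rewrite /rnorm RRe_real //; exact: normr_real. Qed.

Lemma rnorm_ge0 V (x : V) : 0 <= rnorm x.
Proof. by rewrite -lecR -normrE; exact: normr_ge0. Qed.

Lemma rnorm_le V V' (x : V) (y : V') :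
  (`|x| <= `|y| :> C) = (rnorm x <= rnorm y).
Proof. by rewrite -lecR -!normrE. Qed.

Lemma rnorm0 V : rnorm (0 : V) = 0.
Proof. by rewrite /rnorm normr0. Qed.

Lemma rnorm_eq0 V (x : V) : rnorm x = 0 -> x = 0.
Proof. by move=> x0; apply: normr0_eq0; have := normrE x; rewrite x0. Qed.

Lemma rnormN V (x : V) : rnorm (- x) = rnorm x.
Proof. by rewrite /rnorm normrN. Qed.

Lemma rnormBC V (x y : V) : rnorm (x - y) = rnorm (y - x).
Proof. by rewrite -rnormN opprB. Qed.

Lemma rnormD V (x y : V) : rnorm (x + y) <= rnorm x + rnorm y.
Proof.
by rewrite -lecR rmorphD /= -!normrE; exact: ler_normD.
Qed.

Lemma rnormB V (x y : V) : rnorm (x - y) <= rnorm x + rnorm y.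
Proof. by rewrite -(rnormN y); exact: rnormD. Qed.

Lemma rnormZ W (a : C) (x : W) : rnorm (a *: x) = rnorm a * rnorm x.
Proof.
by apply: (@complexI R); rewrite rmorphM /= -!normrE; exact: normrZ.
Qed.

Lemma rnorm_real (a : R) : rnorm (a%:C%C : C) = `|a|.
Proof.
rewrite /rnorm; have -> : `|(a%:C%C : C)| = `|a%:C%C : R[i]| by [].
by rewrite normc_def /= expr0n addr0 sqrtr_sqr.
Qed.

Lemma rnorm_pair V V' (x : V * V') (b : R) :
  rnorm x.1 <= b -> rnorm x.2 <= b -> rnorm x <= b.
Proof.
by rewrite /rnorm [`|x|]prod_normE /Order.max; case: ifP.
Qed.

Lemma rnorm_fst V V' (x : V * V') : rnorm x.1 <= rnorm x.
Proof.
rewrite -rnorm_le [leRHS]prod_normE comparable_le_max ?lexx //.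
exact: real_comparable.
Qed.

Lemma rnorm_snd V V' (x : V * V') : rnorm x.2 <= rnorm x.
Proof.
rewrite -rnorm_le [leRHS]prod_normE comparable_le_max ?lexx ?orbT //.
exact: real_comparable.
Qed.

End RealNorm.

(** * Geometrically Cauchy sequences *)

Section Geometric.
Context {R : realType}.
Local Notation C := (Cplx R).

Lemma geometric_small (c r e : R) : 0 <= r < 1 -> 0 < e ->
  exists N, forall n, (N <= n)%N -> c * r ^+ n < e.
Proof.
move=> /andP[r0 r1] e0.
have r1' : `|r| < 1 by rewrite ger0_norm.
have /cvgrPdist_lt /(_ e e0) [N _ NP] := cvg_geometric c r1'.
exists N => n Nn; have := NP n Nn.
by rewrite /= sub0r normrN /geometric /=; apply: le_lt_trans; exact: ler_norm.
Qed.

Lemma le_geometric_le0 (a c r : R) : 0 <= r < 1 ->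
  (forall n, a <= c * r ^+ n) -> a <= 0.
Proof.
move=> r01 ale; rewrite leNgt; apply/negP => a0.
have [N NP] := geometric_small c r01 a0.
by have := le_lt_trans (ale N) (NP N (leqnn N)); rewrite ltxx.
Qed.

(** The bound is proved with the partial sum of the geometric series, which is
what the induction on [k] preserves. *)
Lemma telescope_geometric (V : normedModType C) (u : nat -> V) (c r : R) :
  0 <= r < 1 -> (forall n, rnorm (u n.+1 - u n) <= c * r ^+ n) ->
  forall n k, rnorm (u (n + k)%N - u n) <= c * r ^+ n / (1 - r).
Proof.
move=> /andP[r0 r1] ule n k.
have c0 : 0 <= c.
  by have := ule 0%N; rewrite expr0 mulr1; apply: le_trans; exact: rnorm_ge0.
have d0 : 0 < 1 - r by rewrite subr_gt0.
have rn0 i : 0 <= r ^+ i by exact: exprn_ge0.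
suff H : rnorm (u (n + k)%N - u n) * (1 - r) <= c * r ^+ n * (1 - r ^+ k).
  rewrite ler_pdivlMr //; apply: (le_trans H).
  by rewrite ler_piMr ?mulr_ge0 // gerBl.
elim: k => [|k IH]; first by rewrite addn0 subrr rnorm0 expr0 subrr mul0r mulr0.
have -> : u (n + k.+1)%N - u n =
    (u (n + k).+1 - u (n + k)%N) + (u (n + k)%N - u n).
  by rewrite addnS subrKA.
apply: le_trans (_ : (rnorm (u (n + k).+1 - u (n + k)%N) +
    rnorm (u (n + k)%N - u n)) * (1 - r) <= _).
  by rewrite ler_pM2r //; exact: rnormD.
rewrite mulrDl.
have H : rnorm (u (n + k).+1 - u (n + k)%N) * (1 - r) <=
    c * r ^+ (n + k) * (1 - r) by rewrite ler_pM2r.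
apply: le_trans (lerD H IH) _.
by rewrite exprD exprS le_eqVlt; apply/orP; left; apply/eqP; ring.
Qed.

End Geometric.

(** * Open mapping theorem *)

Section OpenMapping.
Context {R : realType}.
Local Notation C := (Cplx R).

(** Completeness tested on geometrically Cauchy sequences only, together with the
rate of convergence: this passes to products and to closed subsets without any
structure on the subset. *)
Definition geom_complete (V : normedModType C) (W : set V) : Prop :=
  forall (u : nat -> V) (c r : R), 0 <= r < 1 -> (forall n, W (u n)) ->
    (forall n, rnorm (u n.+1 - u n) <= c * r ^+ n) ->
    exists2 l, W l & forall n, rnorm (l - u n) <= c * r ^+ n / (1 - r).

Lemma banach_geom_complete (X : completeNormedModType C) :
  geom_complete [set: X].
Proof.
move=> u c r r01 _ ule; have tele := telescope_geometric r01 ule.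
have small (e : C) : 0 < e -> exists2 N, forall n k, (N <= n)%N ->
    `|u (n + k)%N - u n| < e & 0 < complex.Re e.
  move=> e0.
  have eE : e = (complex.Re e)%:C%C :> R[i] by rewrite RRe_real // gtr0_real.
  have e0' : 0 < complex.Re e by rewrite -ltcR -eE.
  have [N NP] := geometric_small (c / (1 - r)) r01 e0'.
  exists N => // n k Nn; rewrite [ltLHS]normrE [ltRHS]eE [_ < _]ltcR.
  by apply: le_lt_trans (tele n k) _; rewrite mulrAC; exact: NP.
have /cauchy_cvgP/cvg_ex[l ul] : cauchy (u @ \oo).
  apply: cauchy_exP => e e0; have [N NP _] := small e e0.
  exists (u N), N => // n /= Nn; rewrite -ball_normE /=.
  by rewrite distrC -(subnKC Nn); exact: NP.
exists l => // n; apply/ler_addgt0Pr => e e0.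
have e0' : 0 < (e%:C%C : C) by rewrite -[0]/(0%:C%C) [_ < _]ltcR.
have /cvgrPdist_lt/(_ _ e0')[N _ NP] := ul.
have := NP (n + N)%N (leq_addl _ _).
rewrite /= [ltLHS]normrE [_ < _]ltcR => lu.
rewrite -(subrKA (u (n + N)%N)); apply: (le_trans (rnormD _ _)).
by rewrite addrC lerD ?tele // ltW.
Qed.

Lemma geom_complete_pair (V V' : normedModType C) :
  geom_complete [set: V] -> geom_complete [set: V'] ->
  geom_complete [set: (V * V')%type].
Proof.
move=> cV cV' u c r r01 _ ule.
have [n|l _ lP] := cV (fun n => (u n).1) c r r01 (fun=> I).
  by apply: le_trans (ule n); exact: (rnorm_fst (u n.+1 - u n)).
have [n|l' _ lP'] := cV' (fun n => (u n).2) c r r01 (fun=> I).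
  by apply: le_trans (ule n); exact: (rnorm_snd (u n.+1 - u n)).
by exists (l, l') => // n; apply: rnorm_pair; [exact: lP|exact: lP'].
Qed.

Lemma geom_complete_ker (U V : normedModType C) (A : {linear U -> V}) (M : R) :
  (forall x, rnorm (A x) <= M * rnorm x) -> geom_complete [set: U] ->
  geom_complete (A @^-1` [set 0]).
Proof.
move=> AM cU u c r r01 Au ule; have [l _ lP] := cU u c r r01 (fun=> I) ule.
exists l => //=; apply: rnorm_eq0; apply/eqP; rewrite eq_le rnorm_ge0 andbT.
apply: (@le_geometric_le0 _ _ (`|M| * c / (1 - r)) r r01) => n.
have -> : A l = A (l - u n) by rewrite linearB (Au n) subr0.
apply: (le_trans (AM _)).
apply: le_trans (ler_wpM2r (rnorm_ge0 _) (ler_norm M)) _.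
apply: le_trans (ler_wpM2l (normr_ge0 M) (lP n)) _.
by rewrite le_eqVlt; apply/orP; left; apply/eqP; ring.
Qed.

(** An approximate preimage leaves a remainder smaller by the factor [r]; solving
again for the remainder and adding up gives a geometric series whose sum is an
exact preimage. Keeping the remainders in [W] allows equations that are solvable
only on part of [V]. *)
Lemma solve_by_approximation (U V : normedModType C) (A : {linear U -> V})
    (M K r : R) (W : set V) :
  (forall x, rnorm (A x) <= M * rnorm x) -> geom_complete [set: U] ->
  0 <= K -> 0 <= r < 1 ->
  (forall v, W v -> exists x, [/\ rnorm x <= K * rnorm v, W (v - A x) &
     rnorm (v - A x) <= r * rnorm v]) ->
  forall v, W v -> exists2 x, A x = v & rnorm x <= K / (1 - r) * rnorm v.
Proof.
move=> AM cU K0 r01 step v Wv; have [r0 r1] := andP r01.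
have /choice[f fP] : forall v, exists x, W v -> [/\ rnorm x <= K * rnorm v,
    W (v - A x) & rnorm (v - A x) <= r * rnorm v].
  move=> w; have [Ww|nWw] := pselect (W w); last by exists 0.
  by have [x xP] := step w Ww; exists x.
(* partial sums of the corrections; v - A (u n) is the current remainder *)
pose u := fix u n := if n is n'.+1 then u n' + f (v - A (u n')) else 0.
have uP n : W (v - A (u n)) /\ rnorm (v - A (u n)) <= r ^+ n * rnorm v.
  elim: n => [|n [Wn ln]] /=; first by rewrite linear0 subr0 expr0 mul1r.
  have [_ W' l'] := fP _ Wn.
  rewrite linearD opprD addrA; split => //.
  by apply: (le_trans l'); rewrite exprS -mulrA ler_wpM2l.
have [n|x _ xP] := cU u (K * rnorm v) r r01 (fun=> I).
  rewrite /= [_ - _]addrC addKr; have [Wn ln] := uP n; have [l _ _] := fP _ Wn.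
  by apply: (le_trans l); rewrite -mulrA ler_wpM2l // mulrC.
exists x; last by have := xP 0%N; rewrite /= subr0 expr0 mulr1 mulrAC.
apply/eqP; rewrite -subr_eq0; apply/eqP/rnorm_eq0/eqP.
rewrite eq_le rnorm_ge0 andbT.
apply: (@le_geometric_le0 _ _ (`|M| * (K * rnorm v) / (1 - r) + rnorm v) r r01).
move=> n; rewrite -(subrKA (A (u n))) -linearB; apply: (le_trans (rnormD _ _)).
rewrite mulrDl; apply: lerD; last by rewrite rnormBC mulrC; exact: (uP n).2.
apply: (le_trans (AM _)).
apply: le_trans (ler_wpM2r (rnorm_ge0 _) (ler_norm M)) _.
apply: le_trans (ler_wpM2l (normr_ge0 M) (xP n)) _.
by rewrite le_eqVlt; apply/orP; left; apply/eqP; ring.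
Qed.

(** Gliding hump. If no constant works, there are vectors of the range, of any
prescribed size, that cannot be approximated to half their norm by images of
vectors of size k. Adding or subtracting such a vector of norm 4^-k at stage k,
one of the two signs keeps the sum badly approximable. The limit of the sums is
in the range, say it is A x; for k larger than the norm of x this contradicts
the choice made at stage k, the later stages being too small to matter. *)
Lemma uniform_half_approximation (U V : normedModType C) (A : {linear U -> V}) :
  geom_complete (range A) ->
  exists2 K : R, 0 <= K & forall v, range A v ->
    exists x, rnorm x <= K * rnorm v /\ rnorm (v - A x) <= 2^-1 * rnorm v.
Proof.
move=> cA.
pose P v (r e : R) := exists x, rnorm x <= r /\ rnorm (v - A x) <= e.
apply: contrapT => noK.
have bad (K : R) : 0 <= K ->
    exists2 v, range A v & ~ P v (K * rnorm v) (2^-1 * rnorm v).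
  move=> K0; apply: contrapT => nb; apply: noK; exists K => // v Av.
  by apply: contrapT => nP; apply: nb; exists v.
have P_scale (t : R) v r e : 0 < t -> P ((t%:C%C : C) *: v) (t * r) (t * e) ->
    P v r e.
  move=> t0 [x [xr xe]]; exists (((t^-1)%:C%C : C) *: x).
  have nt y : rnorm (((t^-1)%:C%C : C) *: y : U) = t^-1 * rnorm y.
    by rewrite rnormZ rnorm_real ger0_norm // invr_ge0 ltW.
  split; first by rewrite nt ler_pdivrMl.
  rewrite -(ler_pM2l t0); apply: le_trans xe.
  rewrite -{1}(ger0_norm (ltW t0)) -rnorm_real -rnormZ scalerBr -linearZ.
  by rewrite scalerA -rmorphM /= divff ?gt_eqF // scale1r.
have step (k : nat) w : range A w -> exists w', [/\ range A w',
    rnorm (w' - w) <= 4^-1 ^+ k & ~ P w' k%:R (2^-1 * 4^-1 ^+ k)].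
  move=> Aw; set s := 4^-1 ^+ k.
  have s0 : 0 < s by rewrite exprn_gt0 // invr_gt0.
  have [] := bad (k%:R / s); first by rewrite divr_ge0 ?ler0n // ltW.
  move=> v0 Av0 nPv0.
  have v00 : 0 < rnorm v0.
    rewrite lt_def rnorm_ge0 andbT; apply/eqP => /rnorm_eq0 v0E; apply: nPv0.
    by exists 0; rewrite v0E linear0 subr0 !rnorm0 !mulr0.
  pose t := s / rnorm v0; have t0 : 0 < t by exact: divr_gt0.
  pose v := (t%:C%C : C) *: v0.
  have vs : rnorm v = s.
    by rewrite rnormZ rnorm_real gtr0_norm // divfK // gt_eqF.
  have nPv : ~ P v k%:R (2^-1 * s).
    move=> Pv; apply: nPv0; apply: (@P_scale t) => //.
    suff [-> ->] : t * (k%:R / s * rnorm v0) = k%:R /\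
      t * (2^-1 * rnorm v0) = 2^-1 * s by [].
    by rewrite /t; split; field; rewrite ?gt_eqF.
  have Av : range A v.
    by case: Av0 => x _ xE; exists ((t%:C%C : C) *: x); rewrite // linearZ /= xE.
  have Awv : range A (w + v) /\ range A (w - v).
    case: Aw => x _ <-; case: Av => y _ <-.
    by split; [exists (x + y); rewrite // linearD|
               exists (x - y); rewrite // linearB].
  (* v is half the difference of w + v and w - v, so if both of these had good
   approximations, v would have one *)
  have [Pp|nPp] := pselect (P (w + v) k%:R (2^-1 * s)); last first.
    by exists (w + v); rewrite [_ - _]addrC addKr vs; split => //; exact: Awv.1.
  exists (w - v); rewrite (addrAC w) subrr sub0r rnormN vs.
  split => //; first exact: Awv.2.
  move=> Pm; apply: nPv; case: Pp => x [xk xe]; case: Pm => y [yk ye].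
  pose h : C := (2^-1 : R)%:C%C.
  have hn (Z : normedModType C) (a b : Z) (c : R) :
      rnorm a <= c -> rnorm b <= c -> rnorm (h *: (a - b)) <= c.
    move=> ac bc; rewrite rnormZ rnorm_real ger0_norm ?invr_ge0 //.
    have := rnormB a b; lra.
  have hh (z : V) : h *: (z + z) = z.
    rewrite scalerDr -scalerDl -rmorphD /=.
    suff -> : 2^-1 + 2^-1 = 1 :> R by rewrite scale1r.
    by lra.
  exists (h *: (x - y)); split; first exact: hn.
  suff -> : v - A (h *: (x - y)) = h *: ((w + v - A x) - (w - v - A y)).
    exact: hn.
  rewrite linearZ linearB -{1}(hh v) -scalerBr; congr (_ *: _).
  rewrite (opprD (w - v)) addrACA (opprD w) opprK (addrACA w) subrr add0r.
  by rewrite opprD.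
have /choice[f fP] : forall kw : nat * V, exists w', range A kw.2 ->
    [/\ range A w', rnorm (w' - kw.2) <= 4^-1 ^+ kw.1 & ~ P w' kw.1%:R (2^-1 * 4^-1 ^+ kw.1)].
  move=> [k w]; have [Aw|nAw] := pselect (range A w); last by exists 0.
  by have [w' w'P] := step k w Aw; exists w'.
pose w := fix w n := if n is n'.+1 then f (n', w n') else 0.
have wA n : range A (w n).
  elim: n => [|n IH]; first by exists 0; rewrite ?linear0.
  by have [] := fP (n, w n) IH.
have r01 : 0 <= (4^-1 : R) < 1 by apply/andP; lra.
have [n|l [x _ xl] lP] := cA w 1 4^-1 r01 wA.
  by rewrite mul1r; have [] := fP (n, w n) (wA n).
pose k := Num.Def.archi_bound (rnorm x).
have [_ _] := fP (k, w k) (wA k); apply; exists x; split => /=.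
  by apply: ltW; apply: archi_boundP; exact: rnorm_ge0.
(* the tail after stage k has norm at most 4^-k / 3, less than 4^-k / 2 *)
rewrite rnormBC xl; apply: (le_trans (lP k.+1)).
have : 0 <= 4^-1 ^+ k :> R by rewrite exprn_ge0 // invr_ge0.
have -> : 1 - 4^-1 = 3 / 4 :> R by lra.
by rewrite exprS invf_div; move: (4^-1 ^+ k) => s s0; lra.
Qed.

(** Only the range has to be complete, as a subset of [V]. *)
Theorem open_mapping (U V : normedModType C) (A : {linear U -> V}) (M : R) :
  (forall x, rnorm (A x) <= M * rnorm x) -> geom_complete [set: U] ->
  geom_complete (range A) ->
  exists2 K : R, 0 <= K &
    forall v, range A v -> exists2 x, A x = v & rnorm x <= K * rnorm v.
Proof.
move=> AM cU cA; have [K K0 KP] := uniform_half_approximation cA.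
exists (K / (1 - 2^-1)); first by rewrite divr_ge0 //; lra.
apply: (solve_by_approximation AM cU K0); first by apply/andP; lra.
move=> v Av; have [x [xK xv]] := KP v Av; exists x; split => //.
by case: Av => y _ <-; exists (y - x); rewrite // linearB.
Qed.

End OpenMapping.

(** * Stability of exactness *)

Section Stability.
Context {R : realType} {X : completeNormedModType (Cplx R)}.
Local Notation C := (Cplx R).

(** With [K0], [K1] the open mapping constants of [d0] (onto the kernel of [d1])
and [d1], and [e] so small that [e * K0] and [e * K1] are at most 1/4: preimages
under the original maps are approximate preimages under the perturbed ones. For
a perturbed cycle [u], first subtract a small [v] to make it a cycle of [d1]. *)
Lemma exact_complex_stable (d0 : {linear X -> (X * X)%type})
    (d1 : {linear (X * X)%type -> X}) (M0 M1 : R) :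
  (forall x, rnorm (d0 x) <= M0 * rnorm x) ->
  (forall u, rnorm (d1 u) <= M1 * rnorm u) ->
  exact_complex d0 d1 ->
  exists2 e : R, 0 < e &
    forall (d0' : {linear X -> (X * X)%type}) (d1' : {linear (X * X)%type -> X}),
      (forall x, d1' (d0' x) = 0) ->
      (forall x, rnorm (d0' x - d0 x) <= e * rnorm x) ->
      (forall u, rnorm (d1' u - d1 u) <= e * rnorm u) ->
      exact_complex d0' d1'.
Proof.
move=> d0M d1M [inj mid sur].
have cX : geom_complete [set: X] by exact: banach_geom_complete.
have cXX : geom_complete [set: (X * X)%type] by exact: geom_complete_pair.
have [K0 K0_ge0 K0P] : exists2 K : R, 0 <= K & forall v, d1 v = 0 ->
    exists2 x, d0 x = v & rnorm x <= K * rnorm v.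
  have [|K K_ge0 KP] := open_mapping d0M cX.
    by rewrite mid; exact: geom_complete_ker d1M cXX.
  by exists K => // v v0; apply: KP; rewrite mid.
have [K1 K1_ge0 K1P] : exists2 K : R, 0 <= K & forall v,
    exists2 u, d1 u = v & rnorm u <= K * rnorm v.
  have [|K K_ge0 KP] := open_mapping d1M cXX; first by rewrite sur.
  by exists K => // v; apply: KP; rewrite sur.
pose e : R := (4 * (1 + K0 + K1))^-1.
have D0 : 0 < 4 * (1 + K0 + K1) by lra.
have e0 : 0 < e by rewrite invr_gt0.
have eD : e * (4 * (1 + K0 + K1)) = 1 by rewrite mulVf // gt_eqF.
have eK0 : e * K0 <= 4^-1 by have := mulr_ge0 (ltW e0) K1_ge0; lra.
have eK1 : e * K1 <= 4^-1 by have := mulr_ge0 (ltW e0) K0_ge0; lra.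
clearbody e; exists e => // d0' d1' cpx d0e d1e.
have d0'M x : rnorm (d0' x) <= (M0 + e) * rnorm x.
  have := rnormD (d0' x - d0 x) (d0 x); rewrite subrK.
  by have := d0e x; have := d0M x; lra.
have d1'M u : rnorm (d1' u) <= (M1 + e) * rnorm u.
  have := rnormD (d1' u - d1 u) (d1 u); rewrite subrK.
  by have := d1e u; have := d1M u; lra.
split.
- apply/seteqP; split => x /= x0; last by rewrite x0 linear0.
  have d00 : d1 (d0 x) = 0.
    by have : range d0 (d0 x); [exists x | rewrite mid].
  have [y yx yK] := K0P _ d00.
  have xy : y - x = 0.
    by have : (d0 @^-1` [set 0]) (y - x); [rewrite /= linearB yx subrr|rewrite inj].
  move/eqP: xy; rewrite subr_eq0 => /eqP xy; rewrite xy {xy yx y} in yK.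
  apply: rnorm_eq0; apply/eqP; rewrite eq_le rnorm_ge0 andbT.
  have := d0e x; rewrite x0 sub0r rnormN => d0xe.
  have := ler_wpM2l K0_ge0 d0xe.
  have := ler_wpM2r (rnorm_ge0 x) eK0.
  by have := rnorm_ge0 x; lra.
- apply/seteqP; split => [_ [x _ <-]|u u0] //=.
  suff : forall u, (d1' @^-1` [set 0]) u ->
      exists2 x, d0' x = u & rnorm x <= (K0 * 2) / (1 - 3 / 4) * rnorm u.
    by move=> /(_ u u0)[x xu _]; exists x.
  apply: (solve_by_approximation d0'M cX); first by lra.
    by apply/andP; lra.
  move=> {u u0}u /= u0.
  have [v vu vK] := K1P (d1 u).
  have d1u : rnorm (d1 u) <= e * rnorm u.
    by have := d1e u; rewrite u0 sub0r rnormN.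
  have vu' : rnorm v <= 4^-1 * rnorm u.
    have := ler_wpM2l K1_ge0 d1u; have := ler_wpM2r (rnorm_ge0 u) eK1; lra.
  have [|x xuv xK] := K0P (u - v); first by rewrite linearB vu subrr.
  have uv : rnorm (u - v) <= 5 / 4 * rnorm u by have := rnormB u v; lra.
  have xK' := le_trans xK (ler_wpM2l K0_ge0 uv).
  exists x; split; first by have := mulr_ge0 K0_ge0 (rnorm_ge0 u); lra.
    by rewrite linearB u0 cpx subrr.
  have -> : u - d0' x = v - (d0' x - d0 x).
    by rewrite xuv opprB addrA subrKC.
  apply: (le_trans (rnormB _ _)).
  have := ler_wpM2l (ltW e0) xK'; have := ler_wpM2r (rnorm_ge0 u) eK0.
  by have := d0e x; have := rnorm_ge0 u; lra.
- apply/seteqP; split => // v _.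
  suff : forall v, [set: X] v ->
      exists2 x, d1' x = v & rnorm x <= K1 / (1 - 4^-1) * rnorm v.
    by move=> /(_ v I)[x xv _]; exists x.
  apply: (solve_by_approximation d1'M cXX) => //; first by apply/andP; lra.
  move=> {}v _; have [u uv uK] := K1P v; exists u; split => //.
  rewrite rnormBC -{1}uv; apply: (le_trans (d1e u)).
  have := ler_wpM2l (ltW e0) uK; have := ler_wpM2r (rnorm_ge0 v) eK1; lra.
Qed.

End Stability.

(** * The left spectrum *)

Section LeftSpectrum.
Context {R : realType} {X : completeNormedModType (Cplx R)}.
Local Notation C := (Cplx R).
Implicit Types (q lam : C) (T S : {linear X -> X}).

Lemma l0_linear q T S lam : linear (l0 q T S lam).
Proof.
move=> a u v; apply: injective_projections => /=; first exact: linearP.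
rewrite linearP !scalerDr !scalerN !scalerA (mulrC lam) (mulrC q^-1) opprD.
by rewrite addrACA.
Qed.

HB.instance Definition _ q T S lam :=
  @GRing.isLinear.Build C X (X * X)%type *:%R (l0 q T S lam)
    (l0_linear q T S lam).

Lemma l1_linear T S lam : linear (l1 T S lam).
Proof.
move=> a u v; rewrite /l1 /= !(linearP T, linearP S) scalerDr !scalerBr !opprD.
by rewrite scalerA mulrC -scalerA [X in X + _]addrACA [LHS]addrACA.
Qed.

HB.instance Definition _ T S lam :=
  @GRing.isLinear.Build C (X * X)%type X *:%R (l1 T S lam)
    (l1_linear T S lam).

Lemma l1_l0 q T S lam x : (forall x, T (S x) = q^-1 *: S (T x)) ->
  l1 T S lam (l0 q T S lam x) = 0.
Proof. by move=> TS; rewrite /l1 /= TS (linearB S) !(linearZZ S) subrr. Qed.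

(** Bijectivity of [lam - A], which is all that exactness requires; for a
bounded [A] the open mapping theorem makes it equivalent to [lam] lying outside
the spectrum. *)
Definition regular_at (A : X -> X) lam : Prop :=
  (forall x, lam *: x = A x -> x = 0) /\
  (forall y, exists x, lam *: x - A x = y).

Lemma notin_spectrum_regular (A : {linear X -> X}) lam :
  ~ spectrum A lam -> regular_at A lam.
Proof.
move=> /contrapT[B _ [AB BA]]; split => [x xA|y].
  by rewrite -(AB x) -xA subrr linear0.
exists (B (- y)); rewrite -opprB; have /= -> := BA (- y).
by rewrite opprK.
Qed.

(** [lam^-1 *: v] solves the equation up to [lam^-1 *: A v], so the iteration of
[solve_by_approximation] is the Neumann series. *)
Lemma neumann_regular (A : {linear X -> X}) (M : R) lam : 0 <= M ->
  (forall x, rnorm (A x) <= M * rnorm x) -> M < rnorm lam -> regular_at A lam.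
Proof.
move=> M0 AM Mlam; have l0 := le_lt_trans M0 Mlam.
have lam0 : lam != 0 by apply/eqP => lamE; rewrite lamE rnorm0 ltxx in l0.
split=> [x xA|y].
  apply: rnorm_eq0; apply/eqP; rewrite eq_le rnorm_ge0 andbT leNgt.
  apply/negP => x0; have := AM x; rewrite -xA rnormZ ler_pM2r //.
  by rewrite leNgt Mlam.
have lin : linear (fun x => lam *: x - A x).
  move=> a u v; rewrite (linearP A) scalerDr opprD addrACA scalerBr !scalerA.
  by rewrite (mulrC a).
pose B : {linear X -> X} := HB.pack (fun x => lam *: x - A x)
  (@GRing.isLinear.Build C X X *:%R (fun x => lam *: x - A x) lin).
have BM x : rnorm (B x) <= (rnorm lam + M) * rnorm x.
  by apply: (le_trans (rnormB _ _)); rewrite rnormZ mulrDl lerD2l.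
have li : rnorm (lam^-1) * rnorm lam = 1.
  by rewrite -rnormZ [_ *: _]mulVf // /rnorm normr1.
suff : forall v, [set: X] v -> exists2 x, B x = v &
    rnorm x <= rnorm lam^-1 / (1 - M / rnorm lam) * rnorm v.
  by move=> /(_ y I)[x xy _]; exists x.
apply: (solve_by_approximation BM (@banach_geom_complete _ X)).
- exact: rnorm_ge0.
- by rewrite divr_ge0 ?rnorm_ge0 //= ltr_pdivrMr // mul1r.
move=> v _; exists (lam^-1 *: v); split => //; first by rewrite rnormZ.
rewrite /B /= scalerA divff // scale1r opprB addrC subrK.
apply: (le_trans (AM _)); rewrite rnormZ mulrA.
suff -> : rnorm lam^-1 = (rnorm lam)^-1 by [].
by apply: (mulIf (lt0r_neq0 l0)); rewrite li mulVf // lt0r_neq0.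
Qed.

(** A pair (u, v) with (lam - T) u = S v is the image of (lam - q^-1 T)^-1 v; its
first component is right because [lam - T] is injective. *)
Lemma exact_of_regular q T S lam :
  (forall x, T (S x) = q^-1 *: S (T x)) ->
  regular_at T lam -> regular_at (q^-1 \*: T) lam ->
  exact_complex (l0 q T S lam) (l1 T S lam).
Proof.
move=> TS [Tinj Tsur] [qTinj qTsur]; split.
- apply/seteqP; split => x /= x0; last by rewrite x0 linear0.
  by case: x0 => _ /eqP; rewrite subr_eq0 => /eqP/qTinj.
- apply/seteqP; split => [_ [x _ <-]|[u v] /= uv].
    exact: l1_l0.
  have [x xv] := qTsur v; exists x => //; rewrite /l0 xv; congr pair.
  apply/eqP; rewrite -subr_eq0; apply/eqP/Tinj/eqP.
  rewrite (linearB T) scalerBr -subr_eq0 opprD opprK addrACA.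
  have -> : lam *: S x - T (S x) = S v.
    by rewrite TS -xv (linearB S) !(linearZZ S).
  have -> : T u = lam *: u - S v.
    by apply/eqP; rewrite eq_sym -subr_eq0 addrAC; apply/eqP.
  by rewrite addKr subrr.
- apply/seteqP; split => // y _; have [x xy] := Tsur y.
  by exists (x, 0) => //; rewrite /l1 /= linear0 subr0.
Qed.


Lemma bounded_op_rnorm (A : X -> X) : bounded_op A ->
  exists2 M : R, 0 <= M & forall x, rnorm (A x) <= M * rnorm x.
Proof.
move=> [M AM]; exists `|complex.Re M| => // x.
have := AM x; rewrite [leLHS]normrE [`|x|]normrE.
case: M {AM} => m m' /=; rewrite [_ <= _]lecE /= => /andP[_].
rewrite mulr0 subr0 => /le_trans; apply.
by rewrite ler_wpM2r ?rnorm_ge0 // ler_norm.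
Qed.

Lemma l0_bounded q T S lam : bounded_op T -> bounded_op S ->
  exists M : R, forall x, rnorm (l0 q T S lam x) <= M * rnorm x.
Proof.
move=> /bounded_op_rnorm[M M0 TM] /bounded_op_rnorm[N N0 SN].
have L0 := rnorm_ge0 lam; have Q0 := rnorm_ge0 q^-1.
exists (N + (rnorm lam + rnorm q^-1 * M)) => x; have x0 := rnorm_ge0 x.
have QM : 0 <= rnorm q^-1 * M by exact: mulr_ge0.
apply: rnorm_pair => /=.
  by apply: (le_trans (SN x)); rewrite ler_wpM2r //; lra.
apply: (le_trans (rnormB _ _)); rewrite !rnormZ.
have := ler_wpM2l Q0 (TM x); have := mulr_ge0 N0 x0; lra.
Qed.

Lemma l1_bounded T S lam : bounded_op T -> bounded_op S ->
  exists M : R, forall u, rnorm (l1 T S lam u) <= M * rnorm u.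
Proof.
move=> /bounded_op_rnorm[M M0 TM] /bounded_op_rnorm[N N0 SN].
exists (rnorm lam + M + N) => u; rewrite /l1.
have := rnormB (lam *: u.1 - T u.1) (S u.2).
have := rnormB (lam *: u.1) (T u.1); rewrite rnormZ.
have := ler_wpM2l (rnorm_ge0 lam) (rnorm_fst u).
have := le_trans (TM u.1) (ler_wpM2l M0 (rnorm_fst u)).
have := le_trans (SN u.2) (ler_wpM2l N0 (rnorm_snd u)).
lra.
Qed.

(** The maps of L_mu and L_lam differ by multiples of mu - lam, so stability of
exactness shows that the complement is open. *)
Lemma closed_left_spectrum q T S : bounded_op T -> bounded_op S ->
  (forall x, T (S x) = q^-1 *: S (T x)) -> closed (left_spectrum q T S).
Proof.
move=> bT bS TS; rewrite -openC openE => lam /contrapT ex.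
have [M0 M0P] := l0_bounded q lam bT bS; have [M1 M1P] := l1_bounded lam bT bS.
have [e e0 eP] := exact_complex_stable M0P M1P ex.
have e0' : 0 < (e%:C%C : C) by rewrite -[0]/(0%:C%C) [_ < _]ltcR.
apply/nbhs_ballP; exists (e%:C%C : C) => // mu; rewrite -ball_normE /= => lm.
have {}lm : rnorm (mu - lam) <= e.
  by rewrite rnormBC; move: lm; rewrite [ltLHS]normrE [_ < _]ltcR => /ltW.
apply; apply: eP => [x|x|u]; first exact: l1_l0.
  apply: rnorm_pair => /=.
    by rewrite subrr rnorm0 mulr_ge0 ?rnorm_ge0 // ltW.
  rewrite opprB addrA subrK -scalerBl rnormZ.
  by rewrite ler_wpM2r // rnorm_ge0.
have -> : l1 T S mu u - l1 T S lam u = (mu - lam) *: u.1.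
  by rewrite /l1 scalerBl !opprB addrA subrK addrA subrK.
rewrite rnormZ; apply: ler_pM => //; rewrite ?rnorm_ge0 //; exact: rnorm_fst.
Qed.

Lemma bounded_left_spectrum q T S : bounded_op T ->
  (forall x, T (S x) = q^-1 *: S (T x)) ->
  exists M : R, forall lam, left_spectrum q T S lam -> rnorm lam <= M.
Proof.
move=> /bounded_op_rnorm[M M0 TM] TS.
have Q0 := rnorm_ge0 q^-1; have QM := mulr_ge0 Q0 M0.
exists (M + rnorm q^-1 * M) => lam; apply: contra_notP => /negP; rewrite -ltNge => ll.
apply: exact_of_regular => //.
  by apply: (neumann_regular M0 TM); lra.
apply: (@neumann_regular (q^-1 \*: T) _ _ QM) => [x|]; last by lra.
by rewrite [X in rnorm X]/= rnormZ -mulrA ler_wpM2l.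
Qed.

End LeftSpectrum.

(** * Compactness *)

(** The disc lies in the image of a square of R * R under the continuous map
(x, y) |-> x + i y. *)
Lemma bounded_closed_compact_Cplx (R : realType) (A : set (Cplx R)) (M : R) :
  closed A -> (forall z, A z -> rnorm z <= M) -> compact A.
Proof.
move=> cA AM.
pose f (p : R * R) : Cplx R := (p.1 +i* p.2)%C.
have f_rnorm p : rnorm (f p) <= `|p.1| + `|p.2|.
  have -> : f p = (p.1 +i* 0)%C + (0 +i* p.2)%C :> Cplx R.
    by apply/eqP; rewrite [_ == _]eq_complex /= addr0 add0r !eqxx.
  apply: (le_trans (rnormD _ _)); apply: lerD.
    by rewrite -[X in rnorm X]/(p.1%:C%C) rnorm_real.
  rewrite /rnorm; have -> : `|((0 +i* p.2)%C : Cplx R)| = `|(0 +i* p.2)%C : R[i]| by [].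
  by rewrite normc_def /= expr0n add0r sqrtr_sqr.
have cf : continuous f.
  move=> p; apply/cvgrPdist_lt => e e0.
  have eE : e = (complex.Re e)%:C%C :> R[i] by rewrite RRe_real // gtr0_real.
  have e0' : 0 < complex.Re e by rewrite -ltcR -eE.
  have h0 : 0 < complex.Re e / 2 by rewrite divr_gt0.
  exists (ball p.1 (complex.Re e / 2), ball p.2 (complex.Re e / 2)).
    by split; exact: nbhsx_ballx.
  move=> p' [] /=; rewrite -!ball_normE /= => p1 p2.
  rewrite [ltLHS]normrE [ltRHS]eE [_ < _]ltcR.
  have -> : f p - f p' = f (p - p') by [].
  by apply: (le_lt_trans (f_rnorm _)); rewrite /=; lra.
apply: (@subclosed_compact _ _ (f @` (`[- M, M] `*` `[- M, M]))) => //.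
  apply: continuous_compact; first exact: continuous_subspaceT.
  by apply: compact_setX; exact: segment_compact.
move=> z /AM zM; exists (complex.Re z, complex.Im z); last by case: (z).
have {}zM : Num.sqrt (complex.Re z ^+ 2 + complex.Im z ^+ 2) <= M.
  apply: le_trans zM; rewrite /rnorm.
  have -> : `|z| = `|z : R[i]| by [].
  by rewrite normc_def.
by split; rewrite /= in_itv /= -ler_norml; apply: le_trans zM;
  rewrite -sqrtr_sqr ler_wsqrtr // ?lerDl ?lerDr sqr_ge0.
Qed.

(** * Comparison with the joint spectrum *)

Section JointSpectrum.
Context {R : realType} {X : completeNormedModType (Cplx R)}.
Local Notation C := (Cplx R).

Lemma compact_left_spectrum (q : C) (T S : {linear X -> X}) :
  bounded_op T -> bounded_op S -> (forall x, T (S x) = q^-1 *: S (T x)) ->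
  compact (left_spectrum q T S).
Proof.
move=> bT bS TS; have [M MP] := bounded_left_spectrum bT TS.
exact: bounded_closed_compact_Cplx (closed_left_spectrum bT bS TS) MP.
Qed.

(** The symmetry that exchanges T with S and q with q^-1. *)
Lemma right_spectrumE (q : C) (T S : X -> X) :
  right_spectrum q T S = left_spectrum q^-1 S T.
Proof.
rewrite /right_spectrum /left_spectrum.
suff -> : r0 q T S = l0 q^-1 S T by [].
by apply/funext => mu; apply/funext => x; rewrite /r0 /l0 invrK.
Qed.

(** [phi] is an automorphism of the middle term intertwining the two complexes, up
to the scalar [c] on the last one. *)
Lemma exact_complex_transport (e0 d0 : X -> X * X) (e1 d1 : X * X -> X)
    (phi psi : X * X -> X * X) (c : C) :
  cancel phi psi -> cancel psi phi -> phi 0 = 0 -> c != 0 ->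
  (forall x, d0 x = phi (e0 x)) -> (forall u, d1 (phi u) = c *: e1 u) ->
  exact_complex d0 d1 <-> exact_complex e0 e1.
Proof.
move=> phiK psiK phi0 c0 d0E d1E.
have d0_0 x : d0 x = 0 <-> e0 x = 0.
  by rewrite d0E -[X in _ = X <-> _]phi0; split => [/(can_inj phiK)|->].
have d1_0 u : d1 (phi u) = 0 <-> e1 u = 0.
  rewrite d1E; split => [/eqP|->]; last by rewrite scaler0.
  by rewrite scaler_eq0 (negbTE c0) => /eqP.
split=> -[inj mid sur]; split.
- by rewrite -inj; apply/seteqP; split => x /d0_0.
- apply/seteqP; split => [_ [x _ <-]|u /d1_0 u0].
    by apply/d1_0; rewrite -d0E; have : range d0 (d0 x); [exists x|rewrite mid].
  have : range d0 (phi u) by rewrite mid.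
  by case=> x _; rewrite d0E => /(can_inj phiK) <-; exists x.
- apply/seteqP; split => // y _.
  have : range d1 (c *: y) by rewrite sur.
  case=> u _; rewrite -(psiK u) d1E => /(scalerI c0) <-.
  by exists (psi u).
- by rewrite -inj; apply/seteqP; split => x /d0_0.
- apply/seteqP; split => [_ [x _ <-]|u u0].
    by rewrite d0E; apply/d1_0; have : range e0 (e0 x); [exists x|rewrite mid].
  have : range e0 (psi u) by rewrite mid; apply/d1_0; rewrite psiK.
  by case=> x _ xu; exists x; rewrite // d0E xu psiK.
- apply/seteqP; split => // y _.
  have : range e1 (c^-1 *: y) by rewrite sur.
  case=> u _ uy; exists (phi u) => //.
  by rewrite d1E uy scalerA divff // scale1r.
Qed.

Lemma exact_koszul_x (q : C) (T S : {linear X -> X}) (a : C) : q != 0 ->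
  exact_complex (d0 q T S (a, 0)) (d1 T S (a, 0)) <->
  exact_complex (l0 q T S a) (l1 T S a).
Proof.
move=> q0; have nq0 : - q != 0 by rewrite oppr_eq0.
apply: (@exact_complex_transport _ _ _ _ (fun u => - q *: u)
  (fun u => (- q)^-1 *: u) q) => //.
- exact: scalerK.
- exact: scalerKV.
- by rewrite scaler0.
- move=> x; rewrite /d0 /l0 /= scale0r sub0r; congr pair; first by rewrite scaleNr.
  by rewrite scalerBr !scalerA !mulNr divff // scaleN1r opprK addrC scaleNr.
move=> u; rewrite /d1 /l1 /= (linearZZ T) (linearZZ S) scale0r subr0.
rewrite !scaleNr scalerN opprK !scalerBr !scalerA (mulrC a).
by rewrite [- _ + _]addrC.
Qed.

Lemma exact_koszul_y (q : C) (T S : {linear X -> X}) (b : C) :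
  exact_complex (d0 q T S (0, b)) (d1 T S (0, b)) <->
  exact_complex (r0 q T S b) (r1 T S b).
Proof.
apply: (@exact_complex_transport _ _ _ _ (fun u => (u.2, u.1))
  (fun u => (u.2, u.1)) (-1)) => //.
- by case.
- by case.
- by move=> x; rewrite /d0 /r0 /= mulr0 scale0r subr0.
by move=> u; rewrite /d1 /r1 /= scale0r subr0 scaleN1r !opprB.
Qed.

Lemma left_spectrum_projection (q : C) (T S : {linear X -> X}) :
  (forall x, T (S x) = q^-1 *: S (T x)) ->
  left_spectrum q T S `<=` spectrum T `|` spectrum (q^-1 \*: T).
Proof.
move=> TS lam lS; apply: contrapT => /not_orP[nT nqT]; apply: lS.
by apply: exact_of_regular => //; exact: notin_spectrum_regular.
Qed.

End JointSpectrum.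

Theorem theorem4p1 (R : realType) (q : Cplx R) (X : completeNormedModType (Cplx R))
    (T S : {linear X -> X})
    (q_neq0 : q != 0) (q_neq1 : q != 1)
    (T_bounded : bounded_op T) (S_bounded : bounded_op S)
    (TS : forall x, T (S x) = q^-1 *: S (T x)) :
  sigma_x q T S = left_spectrum q T S `*` [set 0] /\
  sigma_y q T S = [set 0] `*` right_spectrum q T S /\
  joint_spectrum q T S =
    (left_spectrum q T S `*` [set 0]) `|` ([set 0] `*` right_spectrum q T S) /\
  compact (left_spectrum q T S `*` [set (0 : Cplx R)]) /\
  compact ([set (0 : Cplx R)] `*` right_spectrum q T S) /\
  joint_spectrum q T S `<=`
    ((spectrum T `|` spectrum (q^-1 \*: T)) `*` [set 0]) `|`
    ([set 0] `*` (spectrum S `|` spectrum (q \*: S))).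
Proof.
have ST x : S (T x) = q^-1^-1 *: T (S x) by rewrite TS invrK scalerA divff ?scale1r.
have xE : sigma_x q T S = left_spectrum q T S `*` [set 0].
  apply/seteqP; split => -[a b] /=.
    move=> [[_ nex] [_ /= b0]]; split => //= ex; subst b.
    exact/nex/exact_koszul_x.
  move=> [nex /= ->]; split; last by [].
  by split; [left|move/(exact_koszul_x T S a q_neq0)].
have yE : sigma_y q T S = [set 0] `*` right_spectrum q T S.
  apply/seteqP; split => -[a b] /=.
    move=> [[_ nex] [/= a0 _]]; split => //= ex; subst a.
    exact/nex/exact_koszul_y.
  move=> [/= -> nex]; split; last by [].
  by split; [right|move/exact_koszul_y].
have jE : joint_spectrum q T S =
    (left_spectrum q T S `*` [set 0]) `|` ([set 0] `*` right_spectrum q T S).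
  rewrite -xE -yE /sigma_x /sigma_y -setIUr; apply/esym/setIidl.
  by move=> g [].
split => //; split => //; split => //; split; last split.
- by apply: compact_setX; [exact: compact_left_spectrum|exact: compact_set1].
- rewrite right_spectrumE; apply: compact_setX; first exact: compact_set1.
  exact: compact_left_spectrum.
rewrite jE right_spectrumE; apply: setUSS => -[a b] /=.
  by move=> [la b0]; split => //; exact: left_spectrum_projection la.
move=> [a0 lb]; split => //; rewrite -[X in X \*: S]invrK.
exact: left_spectrum_projection lb.
Qed.
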